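(* Let $\epsilon\in\{1,-1\}^n$ with $\epsilon_1=1$ and $\epsilon_n=-1$. Then $\mathcal{W}(\epsilon)=\mathcal{F}(\epsilon)$, i.e. $$\sum_{N\in\mathcal{N}(n;\epsilon)}q^{|\mathcal{E}(N)|}=\sum_{F\in\mathtt{For}(\epsilon)}q^{N(F;\bullet)+N(F;\circ)}.$$
   Context: A network on $n$ points is a set $E$ of pairs $(i,j)$ with $1\le i<j\le n$ (directed edges; $i$ a source, $j$ a sink) with no $(i,j),(j,k)\in E$, satisfying (B1): if $(i,k),(j,l)\in E$ with $i<j<k<l$ then $(j,k)\in E$. $\mathcal{N}(n;\epsilon)$ is the set of such networks in which every source $i$ has $\epsilon_i=1$ and every sink $j$ has $\epsilon_j=-1$; $\mathcal{E}(N)$ denotes the edge set of $N$, and $\mathcal{W}(\epsilon)=\sum_{N\in\mathcal{N}(n;\epsilon)}q^{|\mathcal{E}(N)|}$. Let $i_1<\dots<i_r$ be the positions of the entries $-1$ in $\epsilon$, and $\lambda(\epsilon)=(\lambda_1,\dots,\lambda_r)$ with $\lambda_t=\#\{k:\epsilon_k=1,\ k<i_{r+1-t}\}$, a Young diagram in French notation (row $t$ from the bottom has $\lambda_t$ cells, left justified). A forest is a filling of the cells of $\lambda(\epsilon)$ with each cell empty or pointed such that (F1): no pointed cell has both a pointed cell below it in its column and a pointed cell to its left in its row. $\mathtt{For}(\epsilon)$ is the set of forests. For a forest $F$, $N(F;\bullet)$ is the number of pointed cells, and $N(F;\circ)$ is the number of crossing cells, where a crossing cell is an empty cell having some pointed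 cell below it in its column and some pointed cell to its left in its row (equivalently, where the upward ray from a pointed cell and the rightward ray from another pointed cell meet at an empty cell). *)

(* Defs.v *)
From mathcomp Require Import all_boot all_order all_algebra.

Set Implicit Arguments.
Unset Strict Implicit.
Unset Printing Implicit Defensive.

Import GRing.Theory.

(* Points 1, ..., n are represented by 'I_n, hence shifted by one; a directed
   graph on the n points is identified with its edge set. *)

Definition is_source n (E : {set 'I_n * 'I_n}) (i : 'I_n) : bool :=
  [exists j, (i, j) \in E].

Definition is_sink n (E : {set 'I_n * 'I_n}) (j : 'I_n) : bool :=
  [exists i, (i, j) \in E].

Definition is_network n (E : {set 'I_n * 'I_n}) : bool :=
  [&& [forall i, forall j, ((i, j) \in E) ==> (i < j)%N],
      [forall i, forall j, forall k, ~~ (((i, j) \in E) && ((j, k) \in E))]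
    & [forall i, forall j, forall k, forall l,
        [&& (i, k) \in E, (j, l) \in E, (i < j)%N, (j < k)%N & (k < l)%N]
          ==> ((j, k) \in E)]].

Definition networks n (eps : 'I_n -> int) : {set {set 'I_n * 'I_n}} :=
  [set E | [&& is_network E,
               [forall i, is_source E i ==> (eps i == 1%R)]
             & [forall j, is_sink E j ==> (eps j == (-1)%R)]]].

Definition networks_gf n (eps : 'I_n -> int) : {poly int} :=
  (\sum_(E in networks eps) 'X^(#|E|))%R.

(* [enum 'I_n] is increasing, so [neg_positions eps] is i_1 < ... < i_r, and
   the item of index t - 1 of its reversal is i_{r+1-t}. *)
Definition neg_positions n (eps : 'I_n -> int) : seq 'I_n :=
  [seq i <- enum 'I_n | eps i == (-1)%R].

Definition shape_of n (eps : 'I_n -> int) : seq nat :=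
  [seq #|[set k : 'I_n | (eps k == 1%R) && (k < i)%N]|
     | i : 'I_n <- rev (neg_positions eps)].

(* Cells of the diagram with row lengths lam, in French notation: row 0 is the
   bottom row and column 0 the leftmost one. *)
Definition cell (lam : seq nat) : finType :=
  {t : 'I_(size lam) & 'I_(nth 0%N lam t)}.

Definition cell_row (lam : seq nat) (c : cell lam) : nat := tag c.
Definition cell_col (lam : seq nat) (c : cell lam) : nat := tagged c.

(* A filling by empty and pointed cells is given by its set of pointed cells. *)
Definition pointed_below (lam : seq nat) (F : {set cell lam}) (c : cell lam) :=
  [exists d in F,
     (cell_col d == cell_col c) && (cell_row d < cell_row c)%N].

Definition pointed_left (lam : seq nat) (F : {set cell lam}) (c : cell lam) :=
  [exists d in F,
     (cell_row d == cell_row c) && (cell_col d < cell_col c)%N].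

Definition is_forest (lam : seq nat) (F : {set cell lam}) : bool :=
  [forall c in F, ~~ (pointed_below F c && pointed_left F c)].

Definition crossing_cells (lam : seq nat) (F : {set cell lam}) :
    {set cell lam} :=
  [set c | [&& c \notin F, pointed_below F c & pointed_left F c]].

Definition forests n (eps : 'I_n -> int) : {set {set cell (shape_of eps)}} :=
  [set F | is_forest F].

Definition forests_gf n (eps : 'I_n -> int) : {poly int} :=
  (\sum_(F in forests eps) 'X^(#|F| + #|crossing_cells F|)%N)%R.

(* Main.v *)
Require Import Defs.
From mathcomp Require Import all_boot all_order all_algebra.

(** Placing the edge (i, j) in the column of the source i and the row of the
    sink j identifies networks with the sets of cells that contain each cell
    having a member below it and a member to its left, that is, with the sets
    without crossing cells.  Adding its crossing cells to a forest gives such a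
    set; conversely, deleting from such a set the members with a member below
    and a member to the left gives back the forest, because the lowest member
    of a column and the leftmost member of a row are never deleted. *)

Set Implicit Arguments.
Unset Strict Implicit.
Unset Printing Implicit Defensive.

(** * Forests and fillings without crossing cells *)

Section Fillings.

Variable lam : seq nat.
Implicit Types (A F : {set cell lam}) (c d : cell lam).

Definition crossing_closure F : {set cell lam} := F :|: crossing_cells F.

Definition forest_core A : {set cell lam} :=
  [set c in A | ~~ (pointed_below A c && pointed_left A c)].

Lemma pointed_belowP F c :
  reflect (exists d, [/\ d \in F, cell_col d = cell_col c
                       & (cell_row d < cell_row c)%N])
          (pointed_below F c).
Proof.
apply: (iffP existsP) => [[d /and3P[dF /eqP dc lt_dc]]|[d [dF dc lt_dc]]].
  by exists d.
by exists d; rewrite dF dc eqxx.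
Qed.

Lemma pointed_leftP F c :
  reflect (exists d, [/\ d \in F, cell_row d = cell_row c
                       & (cell_col d < cell_col c)%N])
          (pointed_left F c).
Proof.
apply: (iffP existsP) => [[d /and3P[dF /eqP dc lt_dc]]|[d [dF dc lt_dc]]].
  by exists d.
by exists d; rewrite dF dc eqxx.
Qed.

(** A crossing cell below [c] already has a cell of [F] below it in the same column, so adding
    crossing cells creates no new obstruction. *)
Lemma pointed_below_closure F c :
  pointed_below (crossing_closure F) c = pointed_below F c.
Proof.
apply/pointed_belowP/pointed_belowP => -[d []]; last first.
  by move=> dF dc lt_dc; exists d; rewrite inE dF.
rewrite !inE => /orP[dF dc lt_dc|]; first by exists d.
case/and3P=> _ /pointed_belowP[e [eF ed lt_ed]] _ dc lt_dc.
by exists e; rewrite ed dc (ltn_trans lt_ed).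
Qed.

Lemma pointed_left_closure F c :
  pointed_left (crossing_closure F) c = pointed_left F c.
Proof.
apply/pointed_leftP/pointed_leftP => -[d []]; last first.
  by move=> dF dc lt_dc; exists d; rewrite inE dF.
rewrite !inE => /orP[dF dc lt_dc|]; first by exists d.
case/and3P=> _ _ /pointed_leftP[e [eF ed lt_ed]] dc lt_dc.
by exists e; rewrite ed dc (ltn_trans lt_ed).
Qed.

Lemma pointed_below_core A c :
  pointed_below (forest_core A) c = pointed_below A c.
Proof.
apply/pointed_belowP/pointed_belowP => -[d [dA dc lt_dc]].
  by exists d; move: dA; rewrite inE => /andP[].
pose P e := (e \in A) && (cell_col e == cell_col c).
have Pd : P d by rewrite /P dA dc eqxx.
(* The lowest member [e] of the column has no member below it, hence survives in the core. *)
case: (arg_minnP (fun e => cell_row e) Pd) => e /andP[eA /eqP ec] e_min.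
exists e; split=> //; last by apply: leq_ltn_trans lt_dc; apply: e_min.
rewrite inE eA negb_and; apply/orP; left; apply/pointed_belowP.
case=> f [fA fe]; apply/negP; rewrite -leqNgt; apply: e_min.
by rewrite /P fA fe ec eqxx.
Qed.

Lemma pointed_left_core A c :
  pointed_left (forest_core A) c = pointed_left A c.
Proof.
apply/pointed_leftP/pointed_leftP => -[d [dA dc lt_dc]].
  by exists d; move: dA; rewrite inE => /andP[].
pose P e := (e \in A) && (cell_row e == cell_row c).
have Pd : P d by rewrite /P dA dc eqxx.
case: (arg_minnP (fun e => cell_col e) Pd) => e /andP[eA /eqP ec] e_min.
exists e; split=> //; last by apply: leq_ltn_trans lt_dc; apply: e_min.
rewrite inE eA negb_and; apply/orP; right; apply/pointed_leftP.
case=> f [fA fe]; apply/negP; rewrite -leqNgt; apply: e_min.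
by rewrite /P fA fe ec eqxx.
Qed.

Lemma crossing_cells_closure F : crossing_cells (crossing_closure F) = set0.
Proof.
apply/setP=> c; rewrite !inE pointed_below_closure pointed_left_closure.
by case: (c \in F) => //=; case: (pointed_below F c && _).
Qed.

Lemma forest_core_forest A : is_forest (forest_core A).
Proof.
apply/forall_inP => c; rewrite inE pointed_below_core pointed_left_core.
by case/andP.
Qed.

Lemma crossing_closureK F : is_forest F -> forest_core (crossing_closure F) = F.
Proof.
move=> /forall_inP forF; apply/setP=> c.
rewrite !inE pointed_below_closure pointed_left_closure.
have [cF|_] /= := boolP (c \in F); first exact: forF.
by case: (pointed_below F c && _).
Qed.

Lemma forest_coreK A :
  crossing_cells A = set0 -> crossing_closure (forest_core A) = A.
Proof.
move=> A0; apply/setP=> c.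
rewrite !inE pointed_below_core pointed_left_core.
move/setP/(_ c): A0; rewrite !inE.
by case: (c \in A) => //= _; case: (pointed_below A c && _).
Qed.

Lemma card_crossing_closure F :
  #|crossing_closure F| = #|F| + #|crossing_cells F|.
Proof.
rewrite cardsU (_ : F :&: _ = set0) ?cards0 ?subn0 //.
by apply/setP=> c; rewrite !inE; case: (c \in F).
Qed.

Lemma forest_sum (R : nmodType) (w : nat -> R) :
  (\sum_(F : {set cell lam} | is_forest F) w (#|F| + #|crossing_cells F|)%N
   = \sum_(A : {set cell lam} | crossing_cells A == set0) w #|A|)%R.
Proof.
rewrite [RHS](reindex_onto crossing_closure forest_core) /=; last first.
  by move=> A /eqP/forest_coreK.
apply: eq_big => [F|F _]; last by rewrite card_crossing_closure.
rewrite crossing_cells_closure eqxx /=.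
(* What remains of the range of summation is the fixed-point condition on [F]; it forces [F] to be a
   core, and every core is a forest. *)
apply/idP/eqP => [/crossing_closureK //|<-]; exact: forest_core_forest.
Qed.

End Fillings.

(** In an increasing sequence the entries below [i] form an initial segment. Applied to the sources,
    this tells which columns a row of the diagram meets. *)
Lemma sorted_ltn_count (s : seq nat) (c i : nat) : sorted ltn s ->
  (c < count (fun k => k < i) s) = (c < size s) && (nth 0 s c < i).
Proof.
elim: s c => [|x s IHs] c //= path_s.
have [lt_xi|le_ix] := ltnP x i.
  by case: c => [|c] //=; rewrite add1n ltnS IHs // (path_sorted path_s).
(* The head is already at least [i], so no later entry can be smaller. *)
rewrite add0n (_ : count _ _ = 0); last first.
  apply/eqP; rewrite -leqn0 leqNgt -has_count; apply/hasPn => y ys.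
  move: path_s; rewrite (path_sortedE ltn_trans) => /andP[/allP/(_ y ys) lt_xy _].
  by rewrite -leqNgt (leq_trans le_ix (ltnW lt_xy)).
case: c => [|c] /=; first by rewrite (leq_gtF le_ix).
rewrite ltnS; have [lt_cs|//] := ltnP c (size s); apply/esym/negbTE; rewrite -leqNgt.
move: path_s; rewrite (path_sortedE ltn_trans) => /andP[/allP all_s _].
by rewrite (leq_trans le_ix) // ltnW // all_s // mem_nth.
Qed.

(** * Cells of the diagram as possible edges *)

Section Edges.

Variables (n : nat) (eps : 'I_n.+1 -> int).

Let sources : seq 'I_n.+1 := [seq i <- enum 'I_n.+1 | eps i == 1%R].
Let sinks : seq 'I_n.+1 := rev (neg_positions eps).
Implicit Types c d : cell (shape_of eps).

(** Having [n.+1] points makes [ord0] available as a default value; the indices coming from a cell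
    are always in range, so it is never returned. *)
Definition edge_of c : 'I_n.+1 * 'I_n.+1 :=
  (nth ord0 sources (cell_col c), nth ord0 sinks (cell_row c)).

Let sorted_enum_filter (p : pred 'I_n.+1) :
  sorted ltn [seq val i | i <- enum 'I_n.+1 & p i].
Proof.
rewrite sorted_map; apply: sorted_filter; first by move=> x y z; apply: ltn_trans.
by rewrite -sorted_map val_enum_ord iota_ltn_sorted.
Qed.

Lemma cell_row_lt_size c : cell_row c < size sinks.
Proof.
by have := ltn_ord (tag c); rewrite [X in _ < X -> _]size_map.
Qed.

Lemma nth_shape_of t k : t < size sinks ->
  (k < nth 0 (shape_of eps) t)
  = (k < size sources) && (nth ord0 sources k < nth ord0 sinks t).
Proof.
move=> lt_t; rewrite (nth_map ord0) //.
have -> (i : 'I_n.+1) : #|[set k : 'I_n.+1 | (eps k == 1%R) && (k < i)%N]|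
    = count (fun k => k < i) [seq val k | k <- sources].
  rewrite count_map count_filter cardsE cardE enumT -size_filter.
  by congr size; apply: eq_filter => j; rewrite !inE andbC.
rewrite sorted_ltn_count ?size_map; last exact: sorted_enum_filter.
by case: ltnP => //= lt_k; rewrite (nth_map ord0).
Qed.

Lemma cell_col_lt_size c : cell_col c < size sources.
Proof.
have := ltn_ord (tagged c); rewrite nth_shape_of; first by case/andP.
exact: cell_row_lt_size.
Qed.

Lemma edge_of_col_lt c d :
  (cell_col c < cell_col d) = ((edge_of c).1 < (edge_of d).1).
Proof.
have ltE i j : i < size sources -> j < size sources ->
    i < j -> nth ord0 sources i < nth ord0 sources j.
  move=> lt_i lt_j; rewrite -!(nth_map _ 0 val) //.
  apply: (sorted_ltn_nth ltn_trans) => //; rewrite ?inE ?size_map //.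
  exact: sorted_enum_filter.
have [c_lt d_lt] := (cell_col_lt_size c, cell_col_lt_size d).
rewrite /edge_of /=; case: (ltngtP (cell_col c) (cell_col d)) => [||->].
- by move=> lt_cd; rewrite ltE.
- by move=> lt_dc; rewrite ltnNge ltnW ?ltE.
- by rewrite ltnn.
Qed.

(** Rows are numbered from the bottom while [sinks] is decreasing, so a lower row belongs to a later
    sink; hence the reversal. *)
Lemma edge_of_row_lt c d :
  (cell_row c < cell_row d) = ((edge_of d).2 < (edge_of c).2).
Proof.
have ltE i j : i < size sinks -> j < size sinks ->
    i < j -> nth ord0 sinks j < nth ord0 sinks i.
  move=> lt_i lt_j; rewrite -!(nth_map _ 0 val) //.
  have gtn_trans : transitive gtn by move=> x y z xy yz; apply: ltn_trans xy.
  apply: (sorted_ltn_nth gtn_trans) => //; rewrite ?inE ?size_map //.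
  by rewrite /sinks map_rev rev_sorted sorted_enum_filter.
have [c_lt d_lt] := (cell_row_lt_size c, cell_row_lt_size d).
rewrite /edge_of /=; case: (ltngtP (cell_row c) (cell_row d)) => [||->].
- by move=> lt_cd; rewrite ltE.
- by move=> lt_dc; rewrite ltnNge ltnW ?ltE.
- by rewrite ltnn.
Qed.

Lemma edge_of_col_eq c d :
  (cell_col c == cell_col d) = ((edge_of c).1 == (edge_of d).1).
Proof.
by rewrite eqn_leq !(leqNgt (cell_col _)) !edge_of_col_lt -!leqNgt -eqn_leq.
Qed.

Lemma edge_of_row_eq c d :
  (cell_row c == cell_row d) = ((edge_of c).2 == (edge_of d).2).
Proof.
(* The order reversal exchanges the two inequalities, which [andbC] puts back. *)
by rewrite eqn_leq !(leqNgt (cell_row _)) !edge_of_row_lt -!leqNgt andbC -eqn_leq.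
Qed.

Lemma edge_of_inj : injective edge_of.
Proof.
move=> c d cd.
have /eqP : cell_col c == cell_col d by rewrite edge_of_col_eq cd.
have /eqP : cell_row c == cell_row d by rewrite edge_of_row_eq cd.
case: c {cd} => t k; case: d => t' k'; rewrite /cell_row /cell_col /=.
(* The type of the column depends on the row, so the rows are identified before the columns are
   compared. *)
by move/val_inj=> tt'; case: _ / tt' k' => k' /val_inj ->.
Qed.

Lemma edge_ofP i j :
  reflect (exists c, edge_of c = (i, j))
          [&& eps i == 1%R, eps j == (-1)%R & i < j].
Proof.
have sourceE k : (k \in sources) = (eps k == 1%R).
  by rewrite mem_filter mem_enum andbT.
have sinkE k : (k \in sinks) = (eps k == (-1)%R).
  by rewrite mem_rev mem_filter mem_enum andbT.
apply: (iffP and3P) => [[]|[c [<- <-]]]; last first.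
  rewrite -sourceE -sinkE !mem_nth ?cell_col_lt_size ?cell_row_lt_size //.
  by split=> //; have := ltn_ord (tagged c);
     rewrite nth_shape_of ?cell_row_lt_size // => /andP[].
rewrite -sourceE -sinkE => i_source j_sink lt_ij.
have lt_t : index j sinks < size (shape_of eps) by rewrite size_map index_mem.
have lt_k : index i sources < nth 0 (shape_of eps) (index j sinks).
  by rewrite nth_shape_of ?index_mem // i_source !nth_index.
(* The cell sits at the rank of [i] among the sources and of [j] among the sinks; [i < j] is what
   places it inside the diagram. *)
exists (Tagged (fun t : 'I__ => 'I_(nth 0 (shape_of eps) t))
          (Ordinal lt_k : 'I_(nth 0 (shape_of eps) (Ordinal lt_t)))).
by rewrite /edge_of /cell_col /cell_row /= !nth_index.
Qed.

(** For the cell of [(j, k)], an edge [(j, l)] with [k < l] is a member below it and an edge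
    [(i, k)] with [i < j] a member to its left. So (B1) says that no cell outside [A] is
    crossing. *)
Lemma edge_set_network (A : {set cell (shape_of eps)}) :
  (edge_of @: A \in networks eps) = (crossing_cells A == set0).
Proof.
have edgeP c i j : edge_of c = (i, j) ->
    [/\ eps i = 1%R, eps j = (-1)%R & i < j].
  by move=> cE; have /edge_ofP/and3P[/eqP ? /eqP ?] : exists c, edge_of c = (i, j)
    by exists c.
apply/idP/eqP => [|A0].
  rewrite inE => /and3P[/and3P[_ _ B1] _ _]; apply/setP=> c; rewrite !inE.
  apply/negbTE/and3P => -[cA /pointed_belowP[d [dA /eqP dc lt_dc]]].
  case/pointed_leftP=> e [eA /eqP ec lt_ec]; case/negP: cA.
  rewrite edge_of_col_eq in dc; rewrite edge_of_row_eq in ec.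
  rewrite edge_of_row_lt in lt_dc; rewrite edge_of_col_lt in lt_ec.
  have := imset_f edge_of dA; have := imset_f edge_of eA.
  rewrite -(mem_imset _ _ edge_of_inj).
  case cE: (edge_of c) dc ec lt_dc lt_ec => [j k].
  case: (edge_of d) (edge_of e) => [j' l] [i k'] /= /eqP-> /eqP-> lt_kl lt_ij.
  move=> eE dE; have [_ _ lt_jk] := edgeP _ _ _ cE.
  move/forallP/(_ i)/forallP/(_ j)/forallP/(_ k)/forallP/(_ l): B1.
  by rewrite eE dE lt_ij lt_jk lt_kl.
have imP i j : (i, j) \in edge_of @: A -> exists2 c, c \in A & edge_of c = (i, j).
  by case/imsetP=> c cA ->; exists c.
rewrite inE; apply/and3P; split; first (apply/and3P; split).
- apply/forallP=> i; apply/forallP=> j; apply/implyP => /imP[c _ /edgeP[]//].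
(* The middle point of a directed path would carry both signs. *)
- apply/forallP=> i; apply/forallP=> j; apply/forallP=> k.
  by apply/andP => -[/imP[c _ /edgeP[_ ej _]] /imP[d _ /edgeP[]]]; rewrite ej.
- apply/forallP=> i; apply/forallP=> j; apply/forallP=> k; apply/forallP=> l.
  apply/implyP=> /and5P[/imP[e eA eE] /imP[d dA dE] lt_ij lt_jk lt_kl].
  have [_ ek _] := edgeP _ _ _ eE; have [ej _ _] := edgeP _ _ _ dE.
  have /edge_ofP[c cE] : [&& eps j == 1%R, eps k == (-1)%R & j < k].
    by rewrite ej ek lt_jk !eqxx.
  (* Were [c] not in [A], the cells [d] below it and [e] to its left would make it crossing. *)
  rewrite -cE (mem_imset _ _ edge_of_inj).
  move/setP/(_ c): A0; rewrite !inE; case: (c \in A) => //= /negbT.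
  case/negP; apply/andP; split.
    apply/pointed_belowP; exists d; split=> //; last first.
      by rewrite edge_of_row_lt cE dE.
    by apply/eqP; rewrite edge_of_col_eq cE dE.
  apply/pointed_leftP; exists e; split=> //; last first.
    by rewrite edge_of_col_lt cE eE.
  by apply/eqP; rewrite edge_of_row_eq cE eE.
- apply/forallP=> i; apply/implyP => /existsP[j /imP[c _ /edgeP[-> _ _]]].
  by rewrite eqxx.
- apply/forallP=> j; apply/implyP => /existsP[i /imP[c _ /edgeP[_ -> _]]].
  by rewrite eqxx.
Qed.

(** The sign conditions and the orientation of the edges make every edge of such a network come from
    a cell. *)
Lemma edge_of_preimK (E : {set 'I_n.+1 * 'I_n.+1}) :
  E \in networks eps -> edge_of @: (edge_of @^-1: E) = E.
Proof.
rewrite inE => /and3P[/and3P[lt_E _ _] src snk]; apply/setP=> -[i j].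
apply/imsetP/idP => [[c cE ->]|ijE]; first by rewrite inE in cE.
have /edge_ofP[c cE] : [&& eps i == 1%R, eps j == (-1)%R & i < j].
  apply/and3P; split.
  - by apply: (implyP (forallP src i)); apply/existsP; exists j.
  - by apply: (implyP (forallP snk j)); apply/existsP; exists i.
  - by move/forallP/(_ i)/forallP/(_ j)/implyP: lt_E; apply.
by exists c; rewrite ?inE cE.
Qed.

Lemma networks_gf_cells :
  networks_gf eps
  = (\sum_(A : {set cell (shape_of eps)} | crossing_cells A == set0)
       'X^(#|A|))%R.
Proof.
rewrite /networks_gf.
rewrite (reindex_onto (fun A : {set cell (shape_of eps)} => edge_of @: A)
                         (fun E => edge_of @^-1: E)) /=.
  apply: eq_big => [A|A _]; last by rewrite card_imset //; exact: edge_of_inj.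
  rewrite edge_set_network andbC (_ : _ == A) //.
  by apply/eqP/setP=> c; rewrite inE (mem_imset _ _ edge_of_inj).
exact: edge_of_preimK.
Qed.

End Edges.

Theorem theorem4p19 (n : nat) (epsilon : 'I_n.+1 -> int)
    (eps_pm1 : forall i, epsilon i = 1%R \/ epsilon i = (-1)%R)
    (eps_first : epsilon ord0 = 1%R)
    (eps_last : epsilon ord_max = (-1)%R) :
  networks_gf epsilon = forests_gf epsilon.
Proof.
rewrite networks_gf_cells -(forest_sum _ (fun m => 'X^m)%R).
by apply: eq_bigl => F; rewrite inE.
Qed.
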